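(* Every $f$-block spindle with a one-element block has a right zero element. Therefore, there exist infinite families of spindles (namely, of $f$-block spindles having a one-element block) which can realize any finite commutative group as a torsion subgroup in one-term homology, but which have $\mathbb{Z}$ as their two-term (rack) homology group in all dimensions.
   Context: A spindle is a set $X$ with a binary operation $*$ satisfying $a*a=a$ and $(a*b)*c=(a*c)*(b*c)$ for all $a,b,c\in X$. An $f$-block spindle is built from a family of sets $\{X_i\}_{i\in I}$ (not necessarily finite) and functions $f_i:X_i\to X_i$: on $X=\bigsqcup_{i\in I}X_i$ define, for $x\in X_i$ and $y\in X_j$, $x*y=y$ if $i=j$ and $x*y=f_j(y)$ otherwise. The subsets $X_i$ are called blocks and the maps $f_i$ block functions; $f:X\to X$ denotes the function induced by all the block functions. A right zero is an element $r\in X$ with $x*r=r$ for all $x\in X$. Homology of a right self-distributive $(X,* )$: for $n\ge 0$ let $C_n=\mathbb{Z}X^{n+1}$ be the free abelian group on the $(n+1)$-tuples $(x_0,\dots,x_n)$ of elements of $X$, with $C_{-1}=0$. For $n\ge1$ and $0\le i\le n$ put $d^{( * )}_{i,n}(x_0,\dots,x_n)=(x_0*x_i,\dots,x_{i-1}*x_i,x_{i+1},\dots,x_n)$ and $d^{( *_0)}_{i,n}(x_0,\dots,x_n)=(x_0,\dots,x_{i-1},x_{i+1},\dots,x_n)$ (for $i=0$ both equal $(x_1,\dots,x_n)$), extended linearly. One-term homology: $\partial^{( * )}_n=\sum_{i=0}^n(-1)^i d^{( * )}_{i,n}:C_n\to C_{n-1}$ (with $\partial^{( * )}_0=0$) and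 $H_n^{( * )}(X)=\ker(\partial^{( * )}_n)/\mathrm{im}(\partial^{( * )}_{n+1})$. Two-term (rack) homology: $\partial^R_n=\sum_{i=0}^n(-1)^i\bigl(d^{( *_0)}_{i,n}-d^{( * )}_{i,n}\bigr):C_n\to C_{n-1}$ (with $\partial^R_0=0$) and $H_n^R(X)=\ker(\partial^R_n)/\mathrm{im}(\partial^R_{n+1})$. The torsion part of the claim is drawn from a theorem the paper cites from earlier work on one-term distributive homology of $f$-block spindles, quoted there as: any finite abelian group can be realized as the torsion subgroup of the second homology group of $f$-block spindles having a one-element block. *)

(* Defs.v *)
From HB Require Import structures.
From mathcomp Require Import all_boot all_order all_algebra.
From mathcomp Require Import boolp.
From mathcomp.multinomials Require Import freeg.

Set Implicit Arguments.
Unset Strict Implicit.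
Unset Printing Implicit Defensive.

Import GRing.Theory.
Local Open Scope ring_scope.

Definition spindle_law (X : Type) (op : X -> X -> X) : Prop :=
  (forall a, op a a = a) /\
  (forall a b c, op (op a b) c = op (op a c) (op b c)).

Definition binop_isomorphic (X Y : Type) (opX : X -> X -> X)
    (opY : Y -> Y -> Y) : Prop :=
  exists2 f : X -> Y, bijective f & {morph f : x y / opX x y >-> opY x y}.

(* An arbitrary family of sets is rendered as a family of choiceTypes over a
   choiceType; classically every type carries such a structure. *)
Record fblock := FBlock {
  fb_index : choiceType;
  fb_block : fb_index -> choiceType;
  fb_fun : forall i, fb_block i -> fb_block i
}.

Definition fb_set (D : fblock) : choiceType := {i : fb_index D & fb_block i}.

Definition fb_induced (D : fblock) (y : fb_set D) : fb_set D :=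
  Tagged (@fb_block D) (fb_fun (tagged y)).

Definition fb_op (D : fblock) (x y : fb_set D) : fb_set D :=
  if tag x == tag y then y else fb_induced y.

Lemma fb_op_spindle (D : fblock) : spindle_law (@fb_op D).
Proof.
have tag_op (x y : fb_set D) : tag (fb_op x y) = tag y.
  by rewrite /fb_op; case: ifP.
split=> [a|a b c]; first by rewrite /fb_op eqxx.
by rewrite {1 3}/fb_op !tag_op eqxx {1}/fb_op.
Qed.

Definition has_one_element_block (D : fblock) : Prop :=
  exists (i : fb_index D) (a : fb_block i), forall b : fb_block i, b = a.

Definition zmod_isomorphic (U V : zmodType) : Prop :=
  exists f : {additive U -> V}, bijective f.

Definition is_torsion (G : zmodType) (x : G) : bool :=
  `[< exists2 m : nat, (0 < m)%N & x *+ m = 0 >].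

Lemma is_torsion_zmod_closed (G : zmodType) : zmod_closed (@is_torsion G).
Proof.
split=> [|x y /asboolP[m m0 xm] /asboolP[k k0 yk]]; apply/asboolP.
  by exists 1%N; rewrite ?mul0rn.
exists (m * k)%N; first by rewrite muln_gt0 m0.
by rewrite mulrnBl mulrnA xm mulnC mulrnA yk !mul0rn subrr.
Qed.

HB.instance Definition _ (G : zmodType) :=
  GRing.isZmodClosed.Build G (@is_torsion G) (@is_torsion_zmod_closed G).

Record torsion_subgroup (G : zmodType) := TorsionElement {
  torsion_val : G;
  torsion_valP : is_torsion torsion_val
}.

HB.instance Definition _ (G : zmodType) := [isSub for @torsion_val G].
HB.instance Definition _ (G : zmodType) :=
  [Choice of torsion_subgroup G by <:].
HB.instance Definition _ (G : zmodType) :=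
  [SubChoice_isSubZmodule of torsion_subgroup G by <:].

(* Homology of a sequence of groups ... -> C 2 -> C 1 -> C 0 -> 0, where
   [d n] is the differential C (n + 1) -> C n; the differential leaving C 0 is
   zero, so every element of C 0 is a cycle. *)
Definition is_cycle (C : nat -> zmodType)
    (d : forall n, {additive C n.+1 -> C n}) (n : nat) : C n -> bool :=
  match n return C n -> bool with
  | 0 => fun=> true
  | m.+1 => fun c => d m c == 0
  end.

Lemma is_cycle_zmod_closed (C : nat -> zmodType)
  (d : forall n, {additive C n.+1 -> C n}) (n : nat) :
  zmod_closed (@is_cycle C d n).
Proof.
case: n => [|n] //; split=> [|x y]; rewrite !unfold_in /= ?raddf0 //.
by move=> /eqP dx /eqP dy; rewrite raddfB /= dx dy subrr.
Qed.

HB.instance Definition _ (C : nat -> zmodType)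
    (d : forall n, {additive C n.+1 -> C n}) (n : nat) :=
  GRing.isZmodClosed.Build (C n) (@is_cycle C d n)
    (@is_cycle_zmod_closed C d n).

Record cycles (C : nat -> zmodType)
    (d : forall n, {additive C n.+1 -> C n}) (n : nat) := Cycle {
  cycle_val : C n;
  cycle_valP : is_cycle d cycle_val
}.

HB.instance Definition _ (C : nat -> zmodType)
    (d : forall n, {additive C n.+1 -> C n}) (n : nat) :=
  [isSub for @cycle_val C d n].
HB.instance Definition _ (C : nat -> zmodType)
    (d : forall n, {additive C n.+1 -> C n}) (n : nat) :=
  [Choice of cycles d n by <:].
HB.instance Definition _ (C : nat -> zmodType)
    (d : forall n, {additive C n.+1 -> C n}) (n : nat) :=
  [SubChoice_isSubZmodule of cycles d n by <:].

Definition is_boundary (C : nat -> zmodType)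
    (d : forall n, {additive C n.+1 -> C n}) (n : nat) (z : cycles d n)
    : bool :=
  `[< exists c : C n.+1, d n c = cycle_val z >].

Lemma is_boundary_zmod_closed (C : nat -> zmodType)
  (d : forall n, {additive C n.+1 -> C n}) (n : nat) :
  zmod_closed (@is_boundary C d n).
Proof.
split=> [|x y /asboolP[a ax] /asboolP[b bY]]; apply/asboolP.
  by exists 0; rewrite raddf0 -[RHS]/(val (0 : cycles d n)) raddf0.
by exists (a - b); rewrite raddfB /= ax bY -[RHS]/(val (x - y)) raddfB.
Qed.

HB.instance Definition _ (C : nat -> zmodType)
    (d : forall n, {additive C n.+1 -> C n}) (n : nat) :=
  GRing.isZmodClosed.Build (cycles d n) (@is_boundary C d n)
    (@is_boundary_zmod_closed C d n).

(* The definition divides out by the boundaries that are cycles; when d o d = 0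
   these are all the boundaries, and this is ker / im. *)
Definition homology (C : nat -> zmodType)
    (d : forall n, {additive C n.+1 -> C n}) (n : nat) : zmodType :=
  Quotient.quot (GRing.ZmodClosed.clone (cycles d n) (@is_boundary C d n) _).

Definition chain (X : choiceType) (n : nat) : zmodType :=
  {freeg (n.+1.-tuple X) / int}.

(* (x_0 * x_i, ..., x_{i-1} * x_i, x_{i+1}, ..., x_{n+1}): the j-th entry comes
   from the position [lift i j], i.e. j if j < i and j + 1 otherwise. *)
Definition face (X : Type) (op : X -> X -> X) (n : nat) (i : 'I_n.+2)
    (t : n.+2.-tuple X) : n.+1.-tuple X :=
  [tuple if (j < i)%N then op (tnth t (fintype.lift i j)) (tnth t i)
         else tnth t (fintype.lift i j) | j < n.+1].

Definition dface (X : choiceType) (op : X -> X -> X) (n : nat) (i : 'I_n.+2)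
    : chain X n.+1 -> chain X n :=
  fglift (fun t => << face op i t >> : {freeg (n.+1.-tuple X) / int}).

Lemma dface_zmod_morphism (X : choiceType) (op : X -> X -> X) (n : nat)
  (i : 'I_n.+2) : zmod_morphism (@dface X op n i).
Proof. exact: lift_is_additive. Qed.

HB.instance Definition _ (X : choiceType) (op : X -> X -> X) (n : nat)
    (i : 'I_n.+2) :=
  GRing.isZmodMorphism.Build (chain X n.+1) (chain X n) (@dface X op n i)
    (@dface_zmod_morphism X op n i).

(* The operation *_0, for which [face] just deletes the i-th entry. *)
Definition trivial_op (X : Type) (x y : X) : X := x.

(* The maps below are the differentials C_{n+1} -> C_n, i.e. the ones usually
   indexed by n + 1. *)
Definition bd_one (X : choiceType) (op : X -> X -> X) (n : nat)
    (c : chain X n.+1) : chain X n :=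
  \sum_(i < n.+2) dface op i c *~ (-1) ^+ i.

Definition bd_rack (X : choiceType) (op : X -> X -> X) (n : nat)
    (c : chain X n.+1) : chain X n :=
  \sum_(i < n.+2) (dface (@trivial_op X) i c - dface op i c) *~ (-1) ^+ i.

Lemma bd_one_zmod_morphism (X : choiceType) (op : X -> X -> X) (n : nat) :
  zmod_morphism (@bd_one X op n).
Proof.
move=> a b; rewrite /bd_one -sumrB; apply: eq_bigr => i _.
by rewrite raddfB mulrzBl.
Qed.

HB.instance Definition _ (X : choiceType) (op : X -> X -> X) (n : nat) :=
  GRing.isZmodMorphism.Build (chain X n.+1) (chain X n) (@bd_one X op n)
    (@bd_one_zmod_morphism X op n).

Lemma bd_rack_zmod_morphism (X : choiceType) (op : X -> X -> X) (n : nat) :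
  zmod_morphism (@bd_rack X op n).
Proof.
move=> a b; rewrite /bd_rack -sumrB; apply: eq_bigr => i _.
by rewrite !raddfB -mulrzBl opprD !opprK addrACA.
Qed.

HB.instance Definition _ (X : choiceType) (op : X -> X -> X) (n : nat) :=
  GRing.isZmodMorphism.Build (chain X n.+1) (chain X n) (@bd_rack X op n)
    (@bd_rack_zmod_morphism X op n).

(* Degrees start at 0, so the second group in the list H_0, H_1, ... is
   [H_one op 1]. *)
Definition H_one (X : choiceType) (op : X -> X -> X) (n : nat) : zmodType :=
  homology (fun m => @bd_one X op m) n.

Definition H_rack (X : choiceType) (op : X -> X -> X) (n : nat) : zmodType :=
  homology (fun m => @bd_rack X op m) n.

(* Main.v *)
From HB Require Import structures.
From mathcomp Require Import all_boot all_order all_algebra.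
From mathcomp Require Import all_fingroup all_solvable.
From mathcomp Require Import generic_quotient ring_quotient boolp.
From mathcomp.multinomials Require Import freeg.
Require Import Defs.

Set Implicit Arguments.
Unset Strict Implicit.
Unset Printing Implicit Defensive.

Import GRing.Theory Num.Theory FinRing.Theory.
Local Open Scope ring_scope.

(** The point of a one-element block is fixed by its block function, hence is
    a right zero [r].

    Rack homology.  Appending [r] to every simplex is a chain homotopy, up to
    sign, from the identity to the map [c |-> augmentation c * (r, ..., r)]:
    all faces but the last one commute with appending, and the last face of
    [(x_0, ..., x_n, r)] is [(x_0, ..., x_n)] for the trivial operation and
    [(x_0 * r, ..., x_n * r) = (r, ..., r)] for the given one
    ([bd_rack_cone]).  So every cycle is homologous to a multiple of the cycle
    [(r, ..., r)], and the augmentation, which kills all boundaries, identifies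
    every rack homology group with the integers
    ([rack_homology_right_zero]).

    One-term homology.  Decompose the finite group [A] as a direct sum of
    cyclic groups generated by elements [a_k] of order [n_k].  For every [k]
    take a block with points [0, 1, ..., n_k] and block function
    [0 -> 1 -> 2 -> ... -> n_k -> 1] (a cycle of length [n_k] with one extra
    point leading into it), and add one-point blocks, which is the case
    [n_k = 0].  Let [q (y, z)] be the class of [(y, z)] in the cokernel of
    [C_2 -> C_1], and [F] the map induced by the block functions.  The
    boundaries of [(x, y, z)] for suitable [x], such as the point of a
    one-element block, give
    - [q (z, z) = 0] and [q (z, F z) = 0];
    - [q (F y, z) = q (y, z)] if [y] and [z] lie in different blocks;
    - [q (F y, z) = q (y, z) + q (F z, z)] if they lie in the same block.
    So for [y], [z] in different blocks [q (y, z) = q (0, z)].  Inside a block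
    [q (y, z) = 0] if [z] is on the cycle, since [z] then has a preimage [z']
    and [q (z', z) = 0] forces [q (F z, z) = 0]; and [q (y, 0) = y q (1, 0)]
    with [n_k q (1, 0) = 0].  This is [coker_normal_form].  The first kind of
    classes is free, as seen by the retraction [off_diagonal], and the map
    sending [(y, 0)], with [y] in block [k], to [y a_k] and the other pairs to
    0 kills the boundaries; so it identifies the torsion of the cokernel with
    [A].  The torsion classes are those of combinations of pairs [(1, 0)] inside
    a block, which are cycles, so this torsion is that of [H_1]
    ([lollipops_torsion]).  Varying the number of one-point blocks changes the
    cardinality of the spindle, which yields infinitely many isomorphism
    classes. *)

(** * Chains *)

Section ChainExtension.
Variables (X : choiceType) (n : nat).

(** The generator of the chain group given by a tuple. *)
Definition simplex (t : n.+1.-tuple X) : chain X n := << t >>.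

(** The additive extension to chains of a map defined on tuples.  The target
    is seen as a module over the integers through the alias [zmodule]. *)
Definition extend (V : zmodType) (g : n.+1.-tuple X -> V) (c : chain X n) : V :=
  fglift (g : _ -> zmodule V) c.

Lemma extend_zmod_morphism (V : zmodType) (g : n.+1.-tuple X -> V) :
  zmod_morphism (extend g).
Proof. exact: (lift_is_additive (M := zmodule V)). Qed.

HB.instance Definition _ (V : zmodType) (g : n.+1.-tuple X -> V) :=
  GRing.isZmodMorphism.Build (chain X n) V (extend g) (extend_zmod_morphism g).

Lemma extend_simplex (V : zmodType) (g : n.+1.-tuple X -> V) t :
  extend g (simplex t) = g t.
Proof. by rewrite /extend liftU scale1r. Qed.

(** Additive maps are determined by their values on simplices. *)
Lemma chain_ext (V : zmodType) (f g : chain X n -> V) :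
    zmod_morphism f -> zmod_morphism g ->
  (forall t, f (simplex t) = g (simplex t)) -> f =1 g.
Proof.
move=> fB gB fg c.
pose f' : {additive chain X n -> V} := HB.pack f
  (GRing.isZmodMorphism.Build _ _ f fB).
pose g' : {additive chain X n -> V} := HB.pack g
  (GRing.isZmodMorphism.Build _ _ g gB).
rewrite -[LHS]/(f' c) -[RHS]/(g' c) -[c]freeg_sumE !raddf_sum.
apply: eq_bigr => t _.
have -> : << coeff t c *g t >> = simplex t *~ coeff t c.
  by rewrite /simplex /= freegU_mulz intz.
by rewrite !raddfMz /= fg.
Qed.

Lemma additive_chain_ext (V : zmodType) (f g : {additive chain X n -> V}) :
  (forall t, f (simplex t) = g (simplex t)) -> f =1 g.
Proof. by apply: chain_ext; exact: raddfB. Qed.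

Lemma chain_mulrn_eq0 (c : chain X n) m : (0 < m)%N -> c *+ m = 0 -> c = 0.
Proof.
move=> m0 cm; apply/eqP/freeg_eqP => t; rewrite coeff0; apply/eqP.
have /eqP := congr1 (coeff t) cm.
by rewrite coeffMn coeff0 -mulr_natr mulf_eq0 pnatr_eq0 (gtn_eqF m0) orbF.
Qed.
End ChainExtension.

Lemma dface_simplex (X : choiceType) (op : X -> X -> X) n (i : 'I_n.+2) t :
  dface op i (simplex t) = simplex (face op i t).
Proof. by rewrite /dface liftU scale1r. Qed.

(** * Maps out of homology groups *)

Lemma inj_surj_bijective (U V : choiceType) (f : U -> V) :
  injective f -> (forall v, exists u, f u = v) -> bijective f.
Proof.
move=> f_inj f_surj; have ex v : exists u, f u == v.
  by have [u <-] := f_surj v; exists u.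
have fK v : f (xchoose (ex v)) = v by apply/eqP; exact: (xchooseP (ex v)).
by exists (fun v => xchoose (ex v)) => // u; apply: f_inj; rewrite fK.
Qed.

Section InducedMap.
Variables (C : nat -> zmodType) (d : forall n, {additive C n.+1 -> C n}).
Variables (n : nat) (V : zmodType) (phi : {additive C n -> V}).
Hypothesis phi_d : forall c, phi (d n c) = 0.

(** The map on homology given by the value of [phi] on a representative. *)
Definition induced (h : homology d n) : V := phi (cycle_val (repr h)).

(** The class of a cycle. *)
Definition homology_class (z : cycles d n) : homology d n := (\pi z)%qT.

Lemma homology_class_eq0 z :
  (homology_class z = 0) <-> exists c, d n c = cycle_val z.
Proof.
split=> [/eqP|[c dc]].
  rewrite -[0](raddf0 (\pi_(homology d n))%qT) -Quotient.idealrBE subr0.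
  by move=> /asboolP.
apply/eqP; rewrite -[0](raddf0 (\pi_(homology d n))%qT) -Quotient.idealrBE subr0.
by apply/asboolP; exists c.
Qed.

Lemma cycle_valB (z z' : cycles d n) :
  cycle_val (z - z') = cycle_val z - cycle_val z'.
Proof. exact: (raddfB val). Qed.

Lemma induced_class z : induced (homology_class z) = phi (cycle_val z).
Proof.
rewrite /induced; set z' := repr _.
have : homology_class (z' - z) = 0.
  by rewrite /homology_class raddfB /z' /= reprK subrr.
move=> /homology_class_eq0[c dc]; apply/eqP; rewrite -subr_eq0 -raddfB.
by rewrite -cycle_valB -dc phi_d.
Qed.

Lemma induced_zmod_morphism : zmod_morphism induced.
Proof.
move=> x y; rewrite -[x]reprK -[y]reprK -raddfB !induced_class.
by rewrite cycle_valB raddfB.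
Qed.

(** [induced], bundled as an additive map. *)
Lemma homology_lift :
  exists f : {additive homology d n -> V},
    forall z, f (homology_class z) = phi (cycle_val z).
Proof.
pose f : {additive homology d n -> V} := HB.pack induced
  (GRing.isZmodMorphism.Build _ _ induced induced_zmod_morphism).
by exists f => z; exact: induced_class.
Qed.

(** A map killing the boundaries induces an isomorphism when all the cycles in
    its kernel are boundaries and its restriction to cycles is onto. *)
Lemma homology_isomorphic :
    (forall z, is_cycle d z -> phi z = 0 -> exists c, d n c = z) ->
    (forall v, exists2 z, is_cycle d z & phi z = v) ->
  zmod_isomorphic (homology d n) V.
Proof.
move=> phi_ker phi_surj; have [f fE] := homology_lift.
exists f; apply: inj_surj_bijective => [|v].
  apply: raddf_inj => h; rewrite -[h]reprK fE => /phi_ker[|c dc].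
    exact: cycle_valP.
  by apply/homology_class_eq0; exists c.
by have [z zP <-] := phi_surj v; exists (homology_class (Cycle zP)); rewrite fE.
Qed.

(** The analogous criterion for torsion subgroups: the kernel condition is asked
    of chains with a multiple that is a boundary, and every element of [V] must
    come from such a chain that is also a cycle. *)
Lemma homology_torsion_isomorphic :
    (forall z m c, (0 < m)%N -> d n c = z *+ m -> phi z = 0 ->
       exists c', d n c' = z) ->
    (forall v, exists z m c,
       [/\ is_cycle d z, (0 < m)%N, d n c = z *+ m & phi z = v]) ->
  zmod_isomorphic (torsion_subgroup (homology d n)) V.
Proof.
have cycle_valMn (z : cycles d n) m : cycle_val (z *+ m) = cycle_val z *+ m.
  exact: (raddfMn val).
move=> phi_ker phi_surj; have [f fE] := homology_lift.
have tvB (x y : torsion_subgroup (homology d n)) :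
  torsion_val (x - y) = torsion_val x - torsion_val y by exact: (raddfB val).
pose g x := f (torsion_val x).
have gB : zmod_morphism g by move=> x y; rewrite /g tvB raddfB.
pose g' : {additive torsion_subgroup (homology d n) -> V} := HB.pack g
  (GRing.isZmodMorphism.Build _ _ g gB).
exists g'; apply: inj_surj_bijective => [|v].
  apply: raddf_inj => x; rewrite /= /g => fx0; apply: val_inj.
  rewrite [RHS](raddf0 val) /=; case: x fx0 => h /= /asboolP[m m0].
  rewrite -[h]reprK -/(homology_class _) -raddfMn.
  move=> /homology_class_eq0[c]; rewrite cycle_valMn fE => dc.
  by move=> /(phi_ker _ _ _ m0 dc)[c' dc']; apply/homology_class_eq0; exists c'.
have [z [m [c [zP m0 dc <-]]]] := phi_surj v.
have tP : is_torsion (homology_class (Cycle zP)).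
  apply/asboolP; exists m => //; rewrite -raddfMn.
  by apply/homology_class_eq0; exists c; rewrite cycle_valMn.
by exists (TorsionElement tP); rewrite /= /g fE.
Qed.
End InducedMap.

(** * Rack homology in the presence of a right zero *)

Lemma eq_tuple_nth (X : Type) (x0 : X) n (t t' : n.-tuple X) :
  (forall j, (j < n)%N -> nth x0 t j = nth x0 t' j) -> t = t'.
Proof.
move=> tt'; apply: val_inj; apply: (@eq_from_nth _ x0) => [|j].
  by rewrite !size_tuple.
by rewrite size_tuple => /tt'.
Qed.

Lemma nth_nseq_tuple (X : Type) (x0 x : X) n j :
  nth x0 (nseq_tuple n x) j = if (j < n)%N then x else x0.
Proof. exact: nth_nseq. Qed.

Lemma nth_face (X : Type) (op : X -> X -> X) n (i : 'I_n.+2) t x0 j :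
    (j < n.+1)%N ->
  nth x0 (face op i t) j =
    if (j < i)%N then op (nth x0 t j) (nth x0 t i) else nth x0 t (bump i j).
Proof.
move=> ltj; rewrite -[LHS](tnth_nth x0 _ (Ordinal ltj)) tnth_mktuple.
rewrite !(tnth_nth x0) /=.
by case: ltnP => // ltji; rewrite /bump leqNgt ltji.
Qed.

Section RightZero.
Variables (X : choiceType) (op : X -> X -> X) (r : X).
Hypothesis op_r : right_zero r op.

(** [(x_0, ..., x_n)] becomes [(x_0, ..., x_n, r)]. *)
Definition append n (t : n.+1.-tuple X) : n.+2.-tuple X := [tuple of rcons t r].

(** With default value [r], appending [r] does not change the entries. *)
Lemma nth_append n (t : n.+1.-tuple X) j : nth r (append t) j = nth r t j.
Proof.
rewrite nth_rcons; by case: ltngtP => // lej; rewrite nth_default // ?lej // ltnW.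
Qed.

Lemma face_append_widen (o : X -> X -> X) n (i : 'I_n.+2) t :
  face o (widen_ord (leqnSn _) i) (append t) = append (face o i t).
Proof.
apply: (@eq_tuple_nth _ r) => j ltj.
rewrite nth_face // !nth_append; have [ltj'|lej] := ltnP j n.+1.
  by rewrite nth_face.
have -> : j = n.+1 by apply/eqP; rewrite eqn_leq -ltnS ltj.
rewrite [RHS]nth_default ?size_tuple //= ltnNge leq_ord /=.
by rewrite nth_default // size_tuple /bump leq_ord.
Qed.

Lemma face_append_max n (t : n.+1.-tuple X) :
  face op ord_max (append t) = nseq_tuple n.+1 r.
Proof.
apply: (@eq_tuple_nth _ r) => j ltj.
rewrite nth_nseq_tuple nth_face //= ltj !nth_append.
by rewrite [nth r t n.+1]nth_default ?size_tuple ?op_r.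
Qed.

Lemma face_trivial_append_max n (t : n.+1.-tuple X) :
  face (@trivial_op X) ord_max (append t) = t.
Proof.
apply: (@eq_tuple_nth _ r) => j ltj.
by rewrite nth_face //= ltj /trivial_op nth_append.
Qed.

Lemma face_nseq n (i : 'I_n.+2) (o : X -> X -> X) :
  o r r = r -> face o i (nseq_tuple n.+2 r) = nseq_tuple n.+1 r.
Proof.
move=> orr; apply: (@eq_tuple_nth _ r) => j ltj.
by rewrite nth_face // !nth_nseq_tuple !if_same orr if_same.
Qed.

(** The additive extension of [append], used as a chain homotopy. *)
Definition cone n : {additive chain X n -> chain X n.+1} :=
  @extend X n (chain X n.+1) (fun t => simplex (append t)).

(** The sum of the coefficients. *)
Definition augmentation n : {additive chain X n -> int} :=
  @extend X n int (fun=> 1).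

(** The generator [(r, ..., r)] of the rack homology group. *)
Definition const_simplex n : chain X n := simplex (nseq_tuple n.+1 r).

Lemma cone_simplex n t : cone n (simplex t) = simplex (append t).
Proof. exact: extend_simplex. Qed.

Lemma augmentation_simplex n t : augmentation n (simplex t) = 1.
Proof. exact: extend_simplex. Qed.

Lemma bd_rack_simplex n (t : n.+2.-tuple X) :
  bd_rack op (simplex t) =
  \sum_(i < n.+2) (simplex (face (@trivial_op X) i t) - simplex (face op i t))
     *~ (-1) ^+ i.
Proof. by apply: eq_bigr => i _; rewrite !dface_simplex. Qed.

Lemma augmentation_bd_rack n c : augmentation n (bd_rack op c) = 0.
Proof.
rewrite raddf_sum big1 // => i _; rewrite raddfMz raddfB /=.
rewrite [X in X *~ _](_ : _ = 0) ?mul0rz //.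
pose f (o : X -> X -> X) :=
  [the {additive _ -> _} of augmentation n \o dface o i].
rewrite -[LHS]/(f (@trivial_op X) c - f op c).
rewrite [f _ c](_ : _ = f op c) ?subrr //.
by apply: additive_chain_ext => t /=; rewrite !dface_simplex !augmentation_simplex.
Qed.

Lemma bd_rack_cone_simplex n (t : n.+1.-tuple X) :
  bd_rack op (cone n (simplex t)) =
  \sum_(i < n.+1)
     (simplex (face (@trivial_op X) (widen_ord (leqnSn _) i) (append t))
      - simplex (face op (widen_ord (leqnSn _) i) (append t))) *~ (-1) ^+ i
  + (simplex t - const_simplex n) *~ (-1) ^+ n.+1.
Proof.
rewrite cone_simplex bd_rack_simplex big_ord_recr /=.
by rewrite face_trivial_append_max face_append_max.
Qed.

(** On cycles, [cone] is up to sign a homotopy from the identity to the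
    multiplication of [const_simplex] by the augmentation: the faces other than
    the last add up to the cone over the boundary of [z], or cancel in degree
    0. *)
Lemma bd_rack_cone n (z : chain X n) :
  is_cycle (fun m => @bd_rack X op m) z ->
  bd_rack op (cone n z) =
    (z - const_simplex n *~ augmentation n z) *~ (-1) ^+ n.+1.
Proof.
pose g : {additive chain X n -> chain X n} :=
  @extend X n (chain X n)
    (fun t => (simplex t - const_simplex n) *~ (-1) ^+ n.+1).
have gE c : g c = (c - const_simplex n *~ augmentation n c) *~ (-1) ^+ n.+1.
  pose h (c : chain X n) : chain X n :=
    (c - const_simplex n *~ augmentation n c) *~ (-1) ^+ n.+1.
  have hB : zmod_morphism h.
    move=> c1 c2; rewrite /h raddfB mulrzBr -mulrzBl.
    by rewrite opprD !opprK addrACA opprD opprK.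
  pose h' : {additive chain X n -> chain X n} := HB.pack h
    (GRing.isZmodMorphism.Build _ _ h hB).
  apply: (additive_chain_ext (g := h')) => t.
  by rewrite /= /h extend_simplex augmentation_simplex.
have gS t : g (simplex t) = (simplex t - const_simplex n) *~ (-1) ^+ n.+1.
  exact: extend_simplex.
rewrite -gE; move: g gS {gE}; case: n z => [|n] z g gS zP.
  rewrite -[LHS]/([the {additive _ -> _} of @bd_rack X op 0 \o cone 0] z).
  apply: additive_chain_ext => t.
  rewrite [LHS]bd_rack_cone_simplex big_ord1 gS.
  (* In degree 0 the first face drops the base: it is the same for both
     operations. *)
  have fE o : face o ord0 (append t) = [tuple r].
    apply: (@eq_tuple_nth _ r) => -[|//] _.
    by rewrite nth_face //= nth_append nth_default ?size_tuple.
  rewrite [widen_ord _ _](_ : _ = ord0); last exact: val_inj.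
  by rewrite !fE subrr mul0rz add0r.
have {zP}/eqP zP := zP.
suff -> : bd_rack op (cone n.+1 z) = cone n (bd_rack op z) + g z.
  by rewrite zP raddf0 add0r.
rewrite -[LHS]/([the {additive _ -> _} of @bd_rack X op n.+1 \o cone n.+1] z).
rewrite -[RHS]/([the {additive _ -> _} of (cone n \o @bd_rack X op n) \+ g] z).
apply: additive_chain_ext => t; rewrite [LHS]bd_rack_cone_simplex /=.
rewrite bd_rack_simplex gS raddf_sum; congr (_ + _).
apply: eq_bigr => i _.
by rewrite raddfMz raddfB /= !cone_simplex !face_append_widen.
Qed.

Lemma rack_homology_right_zero n : zmod_isomorphic (H_rack op n) int.
Proof.
apply: (homology_isomorphic (phi := augmentation n)).
- exact: augmentation_bd_rack.
- move=> z zP z0; exists (cone n z *~ (-1) ^+ n.+1).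
  rewrite raddfMz [X in X *~ _]bd_rack_cone // z0 mulr0z subr0 -mulrzA -expr2.
  by rewrite sqrr_sign.
move=> k; exists (const_simplex n *~ k).
  case: n => [//|n]; apply/eqP.
  rewrite raddfMz /= [X in X *~ _](_ : _ = 0) ?mul0rz //.
  rewrite bd_rack_simplex big1 // => i _.
  by rewrite !face_nseq ?subrr ?mul0rz //; exact: op_r.
by rewrite raddfMz /= augmentation_simplex intz.
Qed.
End RightZero.

(** * The cokernel of the second one-term differential *)

Section LowDegreeChains.
Variable X : choiceType.

Definition pair_simplex (y z : X) : chain X 1 := simplex [tuple y; z].
Definition triple_simplex (x y z : X) : chain X 2 := simplex [tuple x; y; z].

Lemma pair_chain_ext (V : zmodType) (f g : chain X 1 -> V) :
    zmod_morphism f -> zmod_morphism g ->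
  (forall y z, f (pair_simplex y z) = g (pair_simplex y z)) -> f =1 g.
Proof.
move=> fB gB fg; apply: chain_ext => //.
case/tupleP=> y t; case/tupleP: t => z t; move: (fg y z).
by congr (f (simplex _) = g (simplex _)); apply: val_inj; rewrite /= (tuple0 t).
Qed.

Lemma triple_chain_ext (V : zmodType) (f g : chain X 2 -> V) :
    zmod_morphism f -> zmod_morphism g ->
  (forall x y z, f (triple_simplex x y z) = g (triple_simplex x y z)) -> f =1 g.
Proof.
move=> fB gB fg; apply: chain_ext => //.
case/tupleP=> x t; case/tupleP: t => y t; case/tupleP: t => z t; move: (fg x y z).
by congr (f (simplex _) = g (simplex _)); apply: val_inj; rewrite /= (tuple0 t).
Qed.

Variable op : X -> X -> X.

Lemma bd_one_pair y z :
  bd_one op (pair_simplex y z) = simplex [tuple z] - simplex [tuple op y z].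
Proof.
rewrite /bd_one !big_ord_recr big_ord0 /= !dface_simplex.
rewrite add0r expr0 expr1 mulr1z mulrN1z.
by congr (simplex _ - simplex _); apply: (@eq_tuple_nth _ y) => -[|//] _;
  rewrite nth_face.
Qed.

Lemma bd_one_triple x y z :
  bd_one op (triple_simplex x y z) =
  pair_simplex y z - pair_simplex (op x y) z + pair_simplex (op x z) (op y z).
Proof.
rewrite /bd_one !big_ord_recr big_ord0 /= !dface_simplex.
rewrite add0r expr0 expr1 sqrrN expr1n !mulr1z mulrN1z.
by congr (simplex _ - simplex _ + simplex _);
  apply: (@eq_tuple_nth _ y) => -[|[|//]] _; rewrite nth_face.
Qed.
End LowDegreeChains.

(** Membership in the image of [f], as a subgroup to divide out by. *)
Definition is_image (U V : zmodType) (f : {additive U -> V}) (v : V) : bool :=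
  `[< exists u, f u = v >].

Lemma is_image_zmod_closed (U V : zmodType) (f : {additive U -> V}) :
  zmod_closed (is_image f).
Proof.
split=> [|_ _ /asboolP[a <-] /asboolP[b <-]]; apply/asboolP.
  by exists 0; rewrite raddf0.
by exists (a - b); rewrite raddfB.
Qed.

HB.instance Definition _ (U V : zmodType) (f : {additive U -> V}) :=
  GRing.isZmodClosed.Build V (is_image f) (is_image_zmod_closed f).

Lemma exists_cokernel (U V : zmodType) (f : {additive U -> V}) :
  exists (Q : zmodType) (p : {additive V -> Q}),
    forall v, p v = 0 <-> exists u, f u = v.
Proof.
pose I := GRing.ZmodClosed.clone V (is_image f) _.
pose p : {additive V -> Quotient.quot I} := (\pi_(Quotient.quot I))%qT.
exists (Quotient.quot I), p => v; rewrite -(raddf0 p).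
split=> [/eqP|[u fu]]; last apply/eqP.
  by rewrite -Quotient.idealrBE subr0 => /asboolP.
by rewrite -Quotient.idealrBE subr0; apply/asboolP; exists u.
Qed.

(** Relations between the classes [q y z] of the pairs [(y, z)], in any group
    where the boundaries of triples vanish, for an [f]-block spindle with a
    one-element block [{b}]. *)
Section CokernelRelations.
Variables (D : fblock) (b : fb_set D).
Hypothesis b_alone : forall x : fb_set D, tag x = tag b -> x = b.
Variables (Q : zmodType) (p : {additive chain (fb_set D) 1 -> Q}).
Hypothesis p_bd : forall c, p (bd_one (@fb_op D) c) = 0.

Let q (y z : fb_set D) : Q := p (pair_simplex y z).
Local Notation F := (@fb_induced D).

Lemma fb_op_same (x y : fb_set D) : tag x = tag y -> fb_op x y = y.
Proof. by move=> xy; rewrite /fb_op xy eqxx. Qed.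

Lemma fb_op_other (x y : fb_set D) : tag x <> tag y -> fb_op x y = F y.
Proof. by move=> /eqP/negPf xy; rewrite /fb_op xy. Qed.

Lemma tag_fb_op (x y : fb_set D) : tag (fb_op x y) = tag y.
Proof. by rewrite /fb_op; case: ifP. Qed.

Lemma coker_triple x y z : q y z + q (fb_op x z) (fb_op y z) = q (fb_op x y) z.
Proof.
apply/eqP; rewrite -subr_eq0 addrAC; apply/eqP.
by rewrite -[RHS](p_bd (triple_simplex x y z)) bd_one_triple raddfD raddfB.
Qed.

Lemma coker_diag z : q z z = 0.
Proof.
by have := coker_triple z z z; rewrite !fb_op_same // -[RHS]addr0 => /addrI.
Qed.

Lemma fb_induced_alone : F b = b.
Proof. exact: b_alone. Qed.

Lemma coker_step_diag z : q z (F z) = 0.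
Proof.
have [/eqP/b_alone->|/eqP zb] := boolP (tag z == tag b).
  by rewrite fb_induced_alone coker_diag.
have := coker_triple z b z.
rewrite fb_op_same // !fb_op_other //; last exact: nesym.
by rewrite fb_induced_alone -[RHS]addr0 => /addrI.
Qed.

Lemma coker_other y z : tag y <> tag z -> q (F y) z = q y z.
Proof.
move=> yz; have := coker_triple z y z.
rewrite fb_op_same // !fb_op_other //; last exact: nesym.
by rewrite coker_step_diag addr0.
Qed.

Lemma coker_same y z : tag y = tag z -> q (F y) z = q y z + q (F z) z.
Proof.
move=> yz; have [/eqP zb|/eqP zb] := boolP (tag z == tag b).
  have -> : y = b by apply: b_alone; rewrite yz.
  by rewrite (b_alone zb) fb_induced_alone coker_diag addr0.
have := coker_triple b y z.
rewrite (fb_op_same yz) fb_op_other => [|/nesym//].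
by rewrite fb_op_other // yz; exact: nesym.
Qed.
End CokernelRelations.

(** * Spindles made of lollipops *)

(** The map [0 -> 1 -> 2 -> ... -> m -> 1] on [{0, ..., m}]; for [m = 0] it is
    the identity of a point. *)
Definition lollipop_step m (i : 'I_m.+1) : 'I_m.+1 :=
  inord (if (i < m)%N then i.+1 else minn 1 m).

(** [N] blocks, the [k]-th one being [{0, ..., n k}] with [lollipop_step]. *)
Definition lollipops (N : nat) (n : nat -> nat) : fblock :=
  @FBlock 'I_N (fun k : 'I_N => 'I_(n k).+1) (fun k => @lollipop_step (n k)).

Section Lollipops.
Variables (N : nat) (n : nat -> nat).
Local Notation X := (fb_set (lollipops N n)).
Local Notation op := (@fb_op (lollipops N n)).
Local Notation F := (@fb_induced (lollipops N n)).

(** A point is given by its block and by its position in the block; [pt] is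
    the inverse, meaningful only for positions up to [n k]. *)
Definition block (x : X) : 'I_N := tag x.
Definition pos (x : X) : nat := nat_of_ord (tagged x : 'I_(n (tag x)).+1).
Definition pt (k : 'I_N) (i : nat) : X :=
  Tagged (@fb_block (lollipops N n)) (inord i : 'I_(n k).+1).

Lemma block_pt k i : block (pt k i) = k. Proof. by []. Qed.

Lemma block_step x : block (F x) = block x. Proof. by []. Qed.

Lemma pos_le x : (pos x <= n (block x))%N.
Proof. exact: leq_ord. Qed.

Lemma pos_pt (k : 'I_N) i : (i <= n k)%N -> pos (pt k i) = i.
Proof. by move=> ik; rewrite /pos /= inordK. Qed.

Lemma pt_pos x : pt (block x) (pos x) = x.
Proof. by case: x => k i; rewrite /pt /pos /= inord_val. Qed.

Lemma pos_step x :
  pos (F x) =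
    if (pos x < n (block x))%N then (pos x).+1 else minn 1 (n (block x)).
Proof.
by rewrite /pos /= inordK //; case: ifP => // _; rewrite ltnS geq_minr.
Qed.

Lemma step_pt (k : 'I_N) i : (i < n k)%N -> F (pt k i) = pt k i.+1.
Proof.
move=> ik; rewrite -[LHS]pt_pos pos_step block_step block_pt.
by rewrite pos_pt; [rewrite ik | exact: ltnW].
Qed.

Lemma step_pt_last k : F (pt k (n k)) = pt k (minn 1 (n k)).
Proof. by rewrite -[LHS]pt_pos pos_step block_step block_pt pos_pt // ltnn. Qed.

(** [y a] if [z] is the position 0 of block [k] and [y] a position in the same
    block, and 0 otherwise. *)
Definition weight (V : zmodType) (a : V) (k : 'I_N) (y z : X) : V :=
  if [&& block y == k, block z == k & pos z == 0%N] then a *+ pos y else 0.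

(** The chain [(y, z)] goes to the sum over [k] of its weights for [a k]; for [a]
    the generators of the cyclic factors of a group, this map detects the
    torsion. *)
Definition weight_hom (V : zmodType) (a : 'I_N -> V) :
    {additive chain X 1 -> V} :=
  @extend X 1 V
    (fun t => \sum_k weight (a k) k (tnth t ord0) (tnth t ord_max)).

Lemma weight_hom_pair (V : zmodType) (a : 'I_N -> V) y z :
  weight_hom a (pair_simplex y z) = \sum_k weight (a k) k y z.
Proof. exact: extend_simplex. Qed.

Lemma block_op x y : block (op x y) = block y.
Proof. exact: (@tag_fb_op (lollipops N n)). Qed.

Lemma weight_diag (V : zmodType) (a : V) k z : weight a k z z = 0.
Proof. by rewrite /weight; case: and3P => // -[_ _ /eqP->]. Qed.

(** The weights satisfy the relations imposed by the boundaries of triples. *)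
Lemma weight_triple (V : zmodType) (a : V) (k : 'I_N) x y z : a *+ n k = 0 ->
  weight a k y z - weight a k (op x y) z + weight a k (op x z) (op y z) = 0.
Proof.
move=> an; have [xy|xy] := eqVneq (tag x) (tag y).
  rewrite (fb_op_same xy) subrr add0r (_ : op x z = op y z) ?weight_diag //.
  by rewrite /fb_op xy.
rewrite (fb_op_other (elimN eqP xy)).
have [zk|zk] := eqVneq (block z) k; last first.
  by rewrite /weight !block_op (negPf zk) !andbF subrr addr0.
have [yk|yk] := eqVneq (block y) k.
  have yz : tag y = tag z by rewrite -/(block y) yk -zk.
  rewrite (fb_op_same yz) fb_op_other; last by rewrite -yz; exact/eqP.
  rewrite /weight !block_step yk zk eqxx /=.
  case: eqP => [z0|_]; last by rewrite subrr addr0.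
  rewrite !pos_step z0 yk zk; have := pos_le y; rewrite yk leq_eqVlt.
  move=> /predU1P[->|yn].
    rewrite ltnn an sub0r (_ : (if _ then _ else _) = minn 1 (n k)) ?addNr //.
    by case: (n k) => // m; rewrite minnSS min0n.
  by rewrite yn (leq_ltn_trans _ yn) // mulr1n mulrSr opprD addrA subrr add0r addNr.
rewrite /weight !block_step (negPf yk) /= subrr add0r.
rewrite (fb_op_other (x := y)); last first.
  by move=> yz; move: yk; rewrite /block yz -/(block z) zk eqxx.
rewrite !block_op !block_step zk eqxx /=; case: eqP => // Fz0.
(* [F z] is at position 0 only if the block of [z] is a single point. *)
suff -> : pos (op x z) = 0%N by [].
apply/eqP; rewrite -leqn0; apply: leq_trans (pos_le _) _; rewrite block_op.
move: Fz0; rewrite pos_step; case: ifP => //; case: (n _) => // m _.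
by rewrite minnSS min0n.
Qed.

Lemma weight_hom_bd (V : zmodType) (a : 'I_N -> V) c :
  (forall k, a k *+ n k = 0) -> weight_hom a (bd_one op c) = 0.
Proof.
move=> an; pose f := [the {additive _ -> _} of weight_hom a \o @bd_one X op 1].
rewrite -[LHS]/(f c); apply: (triple_chain_ext (g := fun=> 0)) => [||x y z].
- exact: raddfB.
- by move=> *; rewrite subr0.
rewrite /f /= bd_one_triple raddfD raddfB /= !weight_hom_pair -sumrB -big_split.
by rewrite big1 //= => k _; rewrite weight_triple.
Qed.

(** The integral coordinates of a chain determine all its weighted sums. *)
Lemma weight_homE (V : zmodType) (a : 'I_N -> V) c :
  weight_hom a c = \sum_k a k *~ weight_hom (fun j => (j == k)%:R : int) c.
Proof.
move: c; apply: pair_chain_ext => [|c c'|y z]; first exact: raddfB.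
  by rewrite -sumrB; apply: eq_bigr => k _; rewrite raddfB mulrzBr.
rewrite weight_hom_pair; apply: eq_bigr => k _.
rewrite weight_hom_pair (bigD1 k) //= big1 => [|j /negPf jk]; last first.
  by rewrite /weight jk; case: ifP; rewrite ?mul0rn.
by rewrite /weight eqxx addr0; case: ifP => _ /=; rewrite ?mulr0z // mulr1n mulrz_nat.
Qed.

(** The map that extracts the free part of the cokernel: pairs in one block go
    to 0, and the first entry of the other pairs is moved to position 0. *)
Definition off_diagonal : {additive chain X 1 -> chain X 1} :=
  @extend X 1 (chain X 1) (fun t =>
    let y := tnth t ord0 in let z := tnth t ord_max in
    if block y == block z then 0 else pair_simplex (pt (block y) 0) z).

Lemma off_diagonal_pair y z :
  off_diagonal (pair_simplex y z) =
    if block y == block z then 0 else pair_simplex (pt (block y) 0) z.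
Proof. exact: extend_simplex. Qed.

Lemma off_diagonal_bd c : off_diagonal (bd_one op c) = 0.
Proof.
pose f := [the {additive _ -> _} of off_diagonal \o @bd_one X op 1].
rewrite -[LHS]/(f c); apply: (triple_chain_ext (g := fun=> 0)) => [||x y z].
- exact: raddfB.
- by move=> *; rewrite subr0.
rewrite /f /= bd_one_triple raddfD raddfB /= !off_diagonal_pair !block_op eqxx.
by rewrite subrr addr0.
Qed.

(** The classes of pairs in a group [Q] where the boundaries vanish, when block
    [b] has one element; [e k] is the class of the pair of positions 1 and 0 in
    block [k]. *)
Section Cokernel.
Variable b : 'I_N.
Hypothesis nb : n b = 0%N.
Variables (Q : zmodType) (p : {additive chain X 1 -> Q}).
Hypothesis p_bd : forall c, p (bd_one op c) = 0.

Let q (y z : X) : Q := p (pair_simplex y z).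
Let e k : Q := q (pt k 1) (pt k 0).

Lemma pt_alone (x : X) : tag x = tag (pt b 0) -> x = pt b 0.
Proof.
move=> xb; rewrite -(pt_pos x) [block x]xb /=; congr (pt _ _); apply/eqP.
by rewrite -leqn0; have := pos_le x; rewrite [block x]xb /= nb.
Qed.

Let q_same := coker_same pt_alone p_bd.
Let q_other := coker_other pt_alone p_bd.
Let q_step := coker_step_diag pt_alone p_bd.
Let q_diag := coker_diag p_bd.

Lemma coker_start (y z : X) : block y != block z -> q y z = q (pt (block y) 0) z.
Proof.
move=> /eqP yz; rewrite -{1}(pt_pos y); have := pos_le y.
elim: (pos y) => // i IHi lti; rewrite -IHi 1?ltnW // -step_pt //.
exact: q_other.
Qed.

Lemma coker_tail (k : 'I_N) i : (i <= n k)%N -> q (pt k i) (pt k 0) = e k *+ i.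
Proof.
elim: i => [|i IHi] lti; first by rewrite /q q_diag.
rewrite -step_pt // /q [LHS]q_same // -/(q _ _) IHi 1?ltnW // mulrSr.
by rewrite step_pt // (leq_ltn_trans _ lti).
Qed.

Lemma coker_order (k : 'I_N) : e k *+ n k = 0.
Proof.
have [->|n0] := posnP (n k); first by rewrite mulr0n.
have := q_same (erefl : tag (pt k (n k)) = tag (pt k 0)).
rewrite -!/(q _ _) step_pt_last (minn_idPl n0) step_pt // coker_tail //.
by rewrite coker_tail // -{1}[e k *+ 1]add0r => /addIr <-.
Qed.

Lemma coker_trivial (k : 'I_N) : n k = 0%N -> e k = 0.
Proof.
move=> nk; rewrite /e (_ : pt k 1 = pt k 0) /q ?q_diag //.
rewrite -[LHS]pt_pos; congr (pt _ _); apply/eqP.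
by rewrite -leqn0 -nk; exact: pos_le.
Qed.

Lemma coker_cycle (y z : X) : block y = block z -> (0 < pos z)%N -> q y z = 0.
Proof.
move=> yz z0; have z_le := pos_le z.
pose z' := pt (block z) (pos z).-1.
have Fz' : F z' = z by rewrite step_pt prednK // pt_pos.
have Fz : q (F z) z = 0.
  have := q_same (erefl : tag z' = tag z).
  have qz' : q z' z = 0 by rewrite -[in RHS](q_step z') Fz'.
  by rewrite Fz' -!/(q _ _) qz' add0r /q q_diag.
have q0 i : (i <= n (block z))%N -> q (pt (block z) i) z = q (pt (block z) 0) z.
  elim: i => // i IHi lti; rewrite -IHi 1?ltnW // -step_pt //.
  by rewrite [LHS]q_same // -!/(q _ _) Fz addr0.
have q_start : q (pt (block z) 0) z = 0.
  by rewrite -(q0 _ z_le) pt_pos; exact: q_diag.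
by rewrite -(pt_pos y) yz q0 // -yz pos_le.
Qed.

(** Modulo boundaries, every chain is the sum of a chain in the free part and
    a combination of the torsion classes [e k]. *)
Lemma coker_normal_form c :
  p c = p (off_diagonal c) + weight_hom e c.
Proof.
move: c; apply: pair_chain_ext => [|c c'|y z]; first exact: raddfB.
  by rewrite !raddfB /= opprD addrACA.
rewrite off_diagonal_pair weight_hom_pair; case: eqVneq => [yz|yz]; last first.
  rewrite big1 ?addr0; first exact: coker_start.
  move=> k _; rewrite /weight; case: and3P => // -[/eqP yk /eqP zk _].
  by rewrite yk zk eqxx in yz.
rewrite raddf0 add0r (bigD1 (block z)) //= big1 ?addr0 => [|k kz]; last first.
  by rewrite /weight [block z == k]eq_sym (negPf kz) andbF.
rewrite /weight yz eqxx /=; case: posnP => [z0|z0]; last exact: coker_cycle.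
have zE : pt (block z) 0 = z by rewrite -z0 pt_pos.
rewrite -coker_tail; last by rewrite -yz pos_le.
by rewrite zE -yz pt_pos.
Qed.
End Cokernel.
End Lollipops.

(** * The torsion of the first one-term homology group *)

(** [A] is the direct sum of cyclic groups generated by the [a k], of order
    [n k], where [k] ranges over the indices with [n k > 0]. *)
Section Torsion.
Variables (N : nat) (n : nat -> nat) (b : 'I_N) (A : zmodType) (a : 'I_N -> A).
Hypothesis nb : n b = 0%N.
Hypothesis a_order : forall k, a k *+ n k = 0.
Hypothesis a_trivial : forall k : 'I_N, n k = 0%N -> a k = 0.
Hypothesis a_gen : forall v, exists z : 'I_N -> nat, v = \sum_k a k *+ z k.
Hypothesis a_indep : forall z : 'I_N -> int, \sum_k a k *~ z k = 0 ->
  forall k : 'I_N, (0 < n k)%N -> (n k %| z k)%Z.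

Local Notation X := (fb_set (lollipops N n)).
Local Notation op := (@fb_op (lollipops N n)).

Lemma lollipops_torsion :
  zmod_isomorphic (torsion_subgroup (H_one op 1)) A.
Proof.
have [Q [p pP]] := exists_cokernel (@bd_one X op 1).
have p_bd c : p (bd_one op c) = 0 by apply/pP; exists c.
pose e k := p (pair_simplex (pt n k 1) (pt n k 0)).
have e_order k : e k *+ n k = 0 by exact: (coker_order nb).
have e_trivial (k : 'I_N) : n k = 0%N -> e k = 0 by exact: (coker_trivial p_bd).
apply: (homology_torsion_isomorphic (phi := weight_hom n a)) => [c|c m d m0 dc c0|v].
- exact: weight_hom_bd.
- (* The free part of [c] is torsion, so it vanishes; and the coordinates of
     [c] are multiples of the orders of the classes [e k]. *)
  have P0 : off_diagonal N n c = 0.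
    by apply: (chain_mulrn_eq0 m0); rewrite -raddfMn -dc off_diagonal_bd.
  apply/pP; rewrite (coker_normal_form nb p_bd) P0 raddf0 add0r weight_homE.
  rewrite big1 // => k _; have [/e_trivial|nk] := posnP (n k).
    by rewrite /e => ->; rewrite mul0rz.
  move: c0; rewrite weight_homE => /a_indep/(_ k nk)/dvdzP[w ->].
  by rewrite mulrC mulrzA -pmulrn [X in X *~ _]e_order mul0rz.
have [z ->] := a_gen v.
pose c : chain X 1 := \sum_k pair_simplex (pt n k 1) (pt n k 0) *+ z k.
have : is_torsion (p c).
  rewrite -[is_torsion _]/(p c \in @is_torsion Q) raddf_sum rpred_sum // => k _.
  rewrite raddfMn rpredMn //; apply/asboolP.
  have [/e_trivial e0|nk] := posnP (n k); last first.
    by exists (n k) => //; exact: e_order.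
  by exists 1%N.
move=> /asboolP[m m0]; rewrite -raddfMn => /pP[d dc]; exists c, m, d; split=> //.
  apply/eqP; rewrite raddf_sum big1 // => k _; rewrite raddfMn /= bd_one_pair.
  by rewrite fb_op_same // subrr mul0rn.
rewrite raddf_sum; apply: eq_bigr => k _; rewrite raddfMn weight_hom_pair.
rewrite (bigD1 k) //= big1 ?addr0 => [|j jk]; last first.
  by rewrite /weight block_pt eq_sym (negPf jk).
congr (_ *+ _); rewrite /weight !block_pt !eqxx pos_pt //=.
have [nk|nk] := posnP (n k); last by rewrite pos_pt.
by rewrite a_trivial ?mul0rn.
Qed.
End Torsion.

(** Different numbers of blocks give different cardinalities. *)
Lemma lollipops_not_isomorphic (n : nat -> nat) (N M : nat) : N <> M ->
  ~ binop_isomorphic (@fb_op (lollipops N n)) (@fb_op (lollipops M n)).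
Proof.
pose T N := {k : 'I_N & 'I_(n k).+1}; pose size_T N := (\sum_(k < N) (n k).+1)%N.
have cardT L : #|{: T L}| = size_T L.
  rewrite card_tagged sumnE big_map big_enum /=.
  by apply: eq_bigr => k _; rewrite card_ord.
have size_lt : {homo size_T : i j / (i < j)%N}.
  apply: homo_ltn; first exact: ltn_trans.
  by move=> i; rewrite /size_T big_ord_recr /= -addn1 leq_add2l.
move=> NM [f f_bij _]; apply: NM.
have : size_T N = size_T M by rewrite -!cardT; exact: (@bij_eq_card (T N) (T M) f).
by move=> NM; case: (ltngtP N M) => // /size_lt; rewrite NM ltnn.
Qed.

(** The structure theorem in additive form.  The sequences of generators and of
    orders are extended by 0 beyond the number [s] of cyclic factors. *)
Lemma finite_abelian_decomposition (A : finZmodType) :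
  exists (s : nat) (a : nat -> A) (n : nat -> nat),
    [/\ forall k, (s <= k)%N -> a k = 0 /\ n k = 0%N,
        forall k, a k *+ n k = 0,
        forall k, (k < s)%N -> (0 < n k)%N,
        forall v, exists z : 'I_s -> nat, v = \sum_(k < s) a k *+ z k &
        forall z : 'I_s -> int, \sum_(k < s) a k *~ z k = 0 ->
          forall k : 'I_s, (n k %| z k)%Z].
Proof.
have [|l lG _] := @abelian_structure A [set: A]%G.
  by apply/centsP=> x _ y _; rewrite /commute !zmodMgE addrC.
pose s := size l; pose a k : A := nth 0 l k.
pose n k := if (k < s)%N then #[a k]%g else 0%N.
have aG : \big[dprod/1%g]_(k < s) <[a k]>%g = [set: A]%G.
  by rewrite -lG (big_nth (0 : A)) big_mkord.
exists s, a, n; split.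
- by move=> k sk; rewrite /n ltnNge sk /a nth_default.
- move=> k; rewrite /n; case: ifP => // _.
  by rewrite -zmodXgE expg_order.
- by move=> k ks; rewrite /n ks order_gt0.
- move=> v.
  have [|c [cP -> _]] := mem_bigdprod aG (x := v); first exact: in_setT.
  have ex k : exists i, c k == a k *+ i.
    by have /cycleP[i ->] := cP k isT; exists i; rewrite zmodXgE.
  exists (fun k => xchoose (ex k)); apply: eq_bigr => k _.
  exact/eqP/(xchooseP (ex k)).
move=> z sum0 k.
have [|c [_ _ cU]] := mem_bigdprod aG (x := (0 : A)); first exact: in_setT.
(* Both 0 and the given summand are the [k]-th component of 0. *)
have a0 : a k *~ z k = 0.
  have -> : a k *~ z k = c k.
    apply: (cU (fun k => a k *~ z k)) => // i _.
    case: (z i) => m; rewrite ?NegzE ?mulrNz -?zmodVgE ?groupV;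
      by rewrite -pmulrn -zmodXgE mem_cycle.
  apply/esym/(cU (fun=> 0)) => // [i _|]; first exact: group1.
  by rewrite big1.
rewrite /n ltn_ord dvdzE /= order_dvdn zmodXgE.
case: (z k) a0 => m /=; rewrite ?NegzE ?mulrNz -pmulrn => /eqP //.
by rewrite oppr_eq0.
Qed.

(** * Conclusion *)

Lemma one_element_block_right_zero (D : fblock) :
  has_one_element_block D -> exists r : fb_set D, right_zero r (@fb_op D).
Proof.
move=> [i [a ai]]; exists (Tagged (@fb_block D) a) => x.
by rewrite /fb_op /fb_induced /=; case: ifP => // _; rewrite [fb_fun _]ai.
Qed.

Theorem mainTheorem5 :
  (forall D : fblock, has_one_element_block D ->
     exists r : fb_set D, right_zero r (@fb_op D)) /\
  (forall D : fblock, has_one_element_block D ->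
     forall n : nat, zmod_isomorphic (H_rack (@fb_op D) n) int) /\
  (forall A : finZmodType,
     exists F : nat -> fblock,
       (forall k l : nat, k <> l ->
          ~ binop_isomorphic (@fb_op (F k)) (@fb_op (F l))) /\
       (forall k : nat, has_one_element_block (F k)) /\
       (forall k : nat,
          zmod_isomorphic (torsion_subgroup (H_one (@fb_op (F k)) 1)) A)).
Proof.
split; first exact: one_element_block_right_zero.
split=> [D /one_element_block_right_zero[r r0] n|A].
  exact: rack_homology_right_zero r0 n.
have [s [a [n [out a_order n_gt0 gen indep]]]] := finite_abelian_decomposition A.
(* The [s] cyclic factors, followed by [m + 1] one-point blocks. *)
exists (fun m => lollipops (s + m.+1) n); split.
  by move=> k l kl; apply: lollipops_not_isomorphic => /addnI [].
have split_sum m (f : nat -> A) : (forall k, (s <= k)%N -> f k = 0) ->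
  \sum_(k < s + m.+1) f k = \sum_(k < s) f k.
  move=> f0; rewrite big_split_ord /= [X in _ + X]big1 ?addr0 // => i _.
  by rewrite f0 ?leq_addr.
have n_end m : n (rshift s (ord0 : 'I_m.+1)) = 0%N.
  by have [] := out (rshift s (ord0 : 'I_m.+1)) (leq_addr _ _).
split=> m.
  exists (rshift s ord0), ord0 => x; apply: val_inj; apply/eqP.
  rewrite /= -leqn0; apply: leq_trans (leq_ord (x : 'I_(n (rshift s ord0)).+1)) _.
  by rewrite n_end.
apply: (@lollipops_torsion _ n (rshift s ord0) _ (fun k => a k)) => //.
- by move=> k nk; have [/n_gt0|/out[]//] := ltnP k s; rewrite nk.
- move=> v; have [z ->] := gen v.
  exists (fun k => if insub (val k) is Some j then z j else 0%N).
  rewrite (split_sum _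
    (fun k => a k *+ (if insub k is Some j then z j else 0%N))).
    by apply: eq_bigr => k _; rewrite valK.
  by move=> k /out[-> _]; rewrite mul0rn.
move=> z; rewrite big_split_ord /= [X in _ + X]big1 ?addr0 => [z0 k nk|i _]; last first.
  by have [-> _] := out (s + i)%N (leq_addr _ _); rewrite mul0rz.
have ks : (k < s)%N.
  by rewrite ltnNge; apply: contraTN nk => /out[_ ->].
have -> : k = lshift m.+1 (Ordinal ks) by exact: val_inj.
exact: (indep _ z0 (Ordinal ks)).
Qed.
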